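(* Let $K$ be a field of characteristic zero, let $n\geq 2$ and $d\geq 2$, let $P=P\langle x_1,x_2,\ldots,x_n\rangle$ be the free Poisson algebra over $K$ in the variables $x_1,\ldots,x_n$, and let $P_0$ be its Veronese subalgebra of degree $d$. Then every locally nilpotent derivation of the Poisson algebra $P_0$ is induced by (i.e. is the restriction to $P_0$ of) a locally nilpotent $d$-graded derivation of the Poisson algebra $P$.
   Context: A Poisson algebra over $K$ is a $K$-vector space with two bilinear operations $x\cdot y$ and $\{x,y\}$ such that it is a commutative associative (unital) algebra under $\cdot$, a Lie algebra under $\{\,,\}$, and the Leibniz identity $\{x,y\cdot z\}=y\cdot\{x,z\}+\{x,y\}\cdot z$ holds. A derivation of a Poisson algebra $R$ is a $K$-linear map $D:R\to R$ with $D(xy)=D(x)y+xD(y)$ and $D(\{x,y\})=\{D(x),y\}+\{x,D(y)\}$ for all $x,y\in R$. It is locally nilpotent if for every $a\in R$ there is $m\ge 1$ with $D^m(a)=0$. The free Poisson algebra $P=P\langle x_1,\ldots,x_n\rangle$ is constructed as follows: let $L$ be the free Lie algebra over $K$ on $x_1,\ldots,x_n$, with a multihomogeneous linear basis $e_1,e_2,\ldots$; then $P$ is the polynomial algebra $K[e_1,e_2,\ldots]$ with the unique Poisson bracket satisfying the Leibniz identity and $\{e_i,e_j\}=[e_i,e_j]$ (bracket of $L$). The degree function on $P$ is determined by $\deg x_i=1$: $\deg e_i$ is the degree of $e_i$ in the free Lie algebra, and $\deg(e_{i_1}\cdots e_{i_s})=\deg e_{i_1}+\cdots+\deg e_{i_s}$.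 For $0\le i\le d-1$ let $P_i$ be the linear span of all homogeneous elements of $P$ of degree $kd+i$, $k\geq 0$. Then $P=P_0\oplus P_1\oplus\cdots\oplus P_{d-1}$ with $P_iP_j\subseteq P_{i+j}$ and $\{P_i,P_j\}\subseteq P_{i+j}$ (indices in $\mathbb{Z}/d\mathbb{Z}$). The Poisson subalgebra $P_0$ is the Veronese subalgebra of $P$ of degree $d$. A derivation $D$ of the Poisson algebra $P$ is called $d$-graded if $D(x_1),\ldots,D(x_n)\in P_1$. *)

(* Defs.v *)
From HB Require Import structures.
From mathcomp Require Import all_boot all_order all_algebra.
From mathcomp Require Import finmap ring.
From mathcomp.multinomials Require Import monalg.

Set Implicit Arguments.
Unset Strict Implicit.
Unset Printing Implicit Defensive.

Import GRing.Theory.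
Local Open Scope ring_scope.

Local Notation "1" := (@mone _) : monom_scope.
Local Notation "x * y" := (mmul x y) : monom_scope.
Local Notation "'U_(' i )" := (@ucm _ i) : monom_scope.

HB.mixin Record Lmodule_isLieAlgebra (K : fieldType) (L : Type)
    of GRing.Lmodule K L := {
  lie : L -> L -> L;
  lie_linearl : forall (c : K) (x y z : L),
    lie (c *: x + y) z = c *: lie x z + lie y z;
  lie_linearr : forall (c : K) (x y z : L),
    lie z (c *: x + y) = c *: lie z x + lie z y;
  liexx : forall x : L, lie x x = 0;
  lie_jacobi : forall x y z : L,
    lie x (lie y z) + lie y (lie z x) + lie z (lie x y) = 0
}.

#[short(type="lieAlgType")]
HB.structure Definition LieAlgebra (K : fieldType) :=
  {L of Lmodule_isLieAlgebra K L & GRing.Lmodule K L}.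

HB.mixin Record LieAlgebra_isPoisson (K : fieldType) (P : Type)
    of LieAlgebra K P & GRing.ComAlgebra K P := {
  lie_leibniz : forall x y z : P, lie x (y * z) = y * lie x z + lie x y * z
}.

#[short(type="poissonAlgType")]
HB.structure Definition PoissonAlgebra (K : fieldType) :=
  {P of LieAlgebra_isPoisson K P & LieAlgebra K P & GRing.ComAlgebra K P}.

Section Derivations.
Variables (K : fieldType) (P : poissonAlgType K).

(* A derivation of a Poisson subalgebra S of P is encoded by a total map on P *)
(* of which only the restriction to S is constrained (and must land in S).    *)
Definition derivation_on (S : {pred P}) (D : P -> P) : Prop :=
  [/\ {in S, forall a, D a \in S},
      {in S &, forall a b, forall c : K, D (c *: a + b) = c *: D a + D b},
      {in S &, forall a b, D (a * b) = D a * b + a * D b}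
    & {in S &, forall a b, D (lie a b) = lie (D a) b + lie a (D b)}].

Definition locally_nilpotent_on (S : {pred P}) (D : P -> P) : Prop :=
  {in S, forall a, exists2 m, (0 < m)%N & iter m D a = 0}.

End Derivations.

Section FreeLie.
Variables (K : fieldType) (n : nat).

Definition lie_morphism (L M : lieAlgType K) (f : L -> M) : Prop :=
  linear f /\ {morph f : u v / lie u v}.

Definition is_free_lie (L : lieAlgType K) (x : 'I_n -> L) : Prop :=
  forall (M : lieAlgType K) (y : 'I_n -> M),
    exists2 f : L -> M, lie_morphism f /\ (forall i, f (x i) = y i)
      & forall g : L -> M,
          lie_morphism g -> (forall i, g (x i) = y i) -> g =1 f.

(* The span of the Lie monomials of multidegree a in the x i (bilinearity     *)
(* makes brackets of spans and spans of brackets agree). Multidegrees are     *)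
(* written as commutative monomials, hence add up under ( * )%M.              *)
Inductive multihomogeneous (L : lieAlgType K) (x : 'I_n -> L) :
    {cmonom 'I_n} -> L -> Prop :=
| Multihomog_gen i : multihomogeneous x U_(i)%M (x i)
| Multihomog_lie a b u v : multihomogeneous x a u -> multihomogeneous x b v ->
    multihomogeneous x (a * b)%M (lie u v)
| Multihomog0 a : multihomogeneous x a 0
| Multihomog_lin a (c : K) u v : multihomogeneous x a u ->
    multihomogeneous x a v -> multihomogeneous x a (c *: u + v).

Definition lincomb (V : lmodType K) (e : nat -> V) (s : seq K) : V :=
  \sum_(i < size s) s`_i *: e i.

Definition linear_basis (V : lmodType K) (e : nat -> V) : Prop :=
  (forall s, lincomb e s = 0 -> forall i, s`_i = 0)
  /\ (forall u, exists s, u == lincomb e s).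

(* For n >= 2 the free Lie algebra has countably infinite dimension, so every *)
(* basis of it can be indexed by nat.                                         *)
Record free_lie_basis := FreeLieBasis {
  fl_lie : lieAlgType K;
  fl_gen : 'I_n -> fl_lie;
  fl_free : is_free_lie fl_gen;
  fl_basis : nat -> fl_lie;
  fl_basisP : linear_basis fl_basis;
  fl_mdeg : nat -> {cmonom 'I_n};
  fl_homog : forall k, multihomogeneous fl_gen (fl_mdeg k) (fl_basis k)
}.

Definition fl_deg (B : free_lie_basis) (k : nat) : nat := mdeg (fl_mdeg B k).

End FreeLie.

Lemma lincombw (K : fieldType) (V : lmodType K) (e : nat -> V) (s : seq K) N :
  (size s <= N)%N -> lincomb e s = \sum_(i < N) s`_i *: e i.
Proof.
move=> le; rewrite /lincomb (big_ord_widen N (fun i => s`_i *: e i) le).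
rewrite [RHS](bigID (fun i : 'I_N => (i < size s)%N)) /= [X in _ + X]big1.
  by rewrite addr0.
by move=> i; rewrite -leqNgt => h; rewrite nth_default ?scale0r.
Qed.

Lemma lincomb_lin (K : fieldType) (c : K) (s t : seq K) :
  exists r, forall (V : lmodType K) (e : nat -> V),
    lincomb e r = c *: lincomb e s + lincomb e t.
Proof.
exists (mkseq (fun i => c * s`_i + t`_i) (maxn (size s) (size t))) => V e.
rewrite (lincombw e (leq_maxl (size s) (size t))).
rewrite (lincombw e (leq_maxr (size s) (size t))).
rewrite /lincomb size_mkseq scaler_sumr -big_split /=; apply: eq_bigr => i _.
by rewrite nth_mkseq // scalerDl scalerA.
Qed.

Section FromGenerators.
Variables (K : fieldType) (A : comAlgType K).

Definition linear_ind (I : Type) (mon : I -> A) : Prop :=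
  forall Q : A -> Prop,
    (forall c f g, Q f -> Q g -> Q (c *: f + g)) -> (forall m, Q (mon m)) ->
  forall f, Q f.

Definition algebra_ind (X : nat -> A) : Prop :=
  forall Q : A -> Prop,
    (forall c f g, Q f -> Q g -> Q (c *: f + g)) -> Q 1 ->
    (forall f g, Q f -> Q g -> Q (f * g)) -> (forall i, Q (X i)) ->
  forall f, Q f.

Lemma leibniz_from_gen (I : Type) (mon : I -> A) (D : A -> A) :
    linear_ind mon -> linear D ->
    (forall m1 m2,
      D (mon m1 * mon m2) = D (mon m1) * mon m2 + mon m1 * D (mon m2)) ->
  forall f g, D (f * g) = D f * g + f * D g.
Proof.
move=> ind Dlin DM f; elim/ind: f => [c f1 f2 h1 h2 g|m1].
  rewrite mulrDl -scalerAl !Dlin h1 h2.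
  by rewrite !mulrDl -!scalerAl scalerDr addrACA.
elim/ind=> [c f1 f2 h1 h2|m2]; last exact: DM.
rewrite mulrDr -scalerAr !Dlin h1 h2.
by rewrite !mulrDr -!scalerAr scalerDr addrACA.
Qed.

Variables (X : nat -> A) (br : A -> A -> A).
Hypothesis indX : algebra_ind X.
Hypothesis brDl : forall c f g h, br (c *: f + g) h = c *: br f h + br g h.
Hypothesis brDr : forall c f g h, br h (c *: f + g) = c *: br h f + br h g.
Hypothesis brMl : forall f g h, br (f * g) h = br f h * g + f * br g h.
Hypothesis brMr : forall f g h, br h (f * g) = f * br h g + br h f * g.

Let br1l f : br 1 f = 0.
Proof.
have := brMl 1 1 f; rewrite !mul1r mulr1 => h.
by apply: (addrI (br 1 f)); rewrite addr0 -h.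
Qed.

Let br1r f : br f 1 = 0.
Proof.
have := brMr 1 1 f; rewrite !mul1r mulr1 => h.
by apply: (addrI (br f 1)); rewrite addr0 -h.
Qed.

Let br0r f : br f 0 = 0.
Proof. by have := brDr (-1) 0 0 f; rewrite scaler0 addr0 scaleN1r addNr. Qed.

Hypothesis brC_gen : forall i j, br (X i) (X j) = - br (X j) (X i).

Lemma brC_from_gen f g : br f g = - br g f.
Proof.
elim/indX: f g => [c f1 f2 h1 h2 g|g|f1 f2 h1 h2 g|i g].
- by rewrite brDl brDr h1 h2 scalerN opprD.
- by rewrite br1l br1r oppr0.
- by rewrite brMl brMr h1 h2 mulNr mulrN opprD addrC.
elim/indX: g => [c f1 f2 h1 h2||f1 f2 h1 h2|j].
- by rewrite brDl brDr h1 h2 scalerN opprD.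
- by rewrite br1l br1r oppr0.
- by rewrite brMl brMr h1 h2 mulNr mulrN opprD addrC.
exact: brC_gen.
Qed.

Lemma brxx_from_gen : (forall i, br (X i) (X i) = 0) -> forall f, br f f = 0.
Proof.
move=> brxxX; elim/indX=> [c f g h1 h2||f g h1 h2|//].
- rewrite brDl !brDr h1 h2 (brC_from_gen g f) scaler0 add0r addr0.
  by rewrite scalerN addrN.
- exact: br1l.
by rewrite brMl !brMr h1 h2 (brC_from_gen g f); ring.
Qed.

Let jac f g h : A := br f (br g h) - br g (br f h) - br (br f g) h.

Let jacE f g h : jac f g h = br f (br g h) + br g (br h f) + br h (br f g).
Proof.
rewrite /jac (brC_from_gen h (br f g)) (brC_from_gen h f); congr (_ + _ - _).
by have := brDr (-1) (br f h) 0 g; rewrite br0r !addr0 !scaleN1r => ->.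
Qed.

Let jac_gen f g : (forall k, jac f g (X k) = 0) -> forall h, jac f g h = 0.
Proof.
have brA a b c : br c (a + b) = br c a + br c b.
  by have := brDr 1 a b c; rewrite !scale1r.
move=> H; elim/indX=> [c h1 h2 E1 E2||h1 h2 E1 E2|//].
- transitivity (c *: jac f g h1 + jac f g h2); last first.
    by rewrite E1 E2 scaler0 addr0.
  rewrite /jac !brDr !scalerBr !opprD.
  by rewrite [RHS]addrACA; congr (_ + _); rewrite addrACA.
- by rewrite /jac !br1r !br0r !subr0.
transitivity (h1 * jac f g h2 + jac f g h1 * h2); last first.
  by rewrite E1 E2 mulr0 mul0r addr0.
by rewrite /jac !(brMr, brA); ring.
Qed.

Lemma jacobi_from_gen :
    (forall i j k, br (X i) (br (X j) (X k)) + br (X j) (br (X k) (X i))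
                   + br (X k) (br (X i) (X j)) = 0) ->
  forall f g h, br f (br g h) + br g (br h f) + br h (br f g) = 0.
Proof.
have rot a b c : jac a b c = jac b c a by rewrite !jacE -addrA addrC.
move=> jacX f g h; rewrite -jacE; move: h; apply: jac_gen => k; rewrite -rot.
move: g; apply: jac_gen => j; rewrite -rot.
by move: f; apply: jac_gen => i; rewrite jacE.
Qed.

End FromGenerators.

Section PolynomialDerivation.
Variable K : fieldType.
Local Notation P := {malg K[{cmonom nat}]}.
Implicit Types (f g h : P) (m : {cmonom nat}) (phi psi : nat -> P).

Definition pvar (i : nat) : P := << U_(i)%M >>.

Definition mderiv phi m : P :=
  \sum_(i <- finsupp m) (m i)%:R *: (<< divcm m U_(i)%M >> * phi i).

(* The K-linear derivation of the polynomial algebra sending pvar i to phi i. *)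
Definition pderiv phi f : P := \sum_(m <- msupp f) f@_m *: mderiv phi m.

Lemma pderivE phi f : pderiv phi f = mmap (@mkmalgU _ K 1%M) (mderiv phi) f.
Proof. by apply: eq_bigr => m _; rewrite mul_malgC. Qed.

Lemma pderiv_lin phi c f g :
  pderiv phi (c *: f + g) = c *: pderiv phi f + pderiv phi g.
Proof.
rewrite !pderivE raddfD; congr (_ + _); rewrite -[in RHS]pderivE.
transitivity (\sum_(m <- msupp f) (c *: f)@_m *: mderiv phi m).
  rewrite /= (mmapEw (f := @mkmalgU _ K 1%M) (msuppZ_le c f)).
  by apply: eq_bigr => m _; rewrite mul_malgC.
rewrite scaler_sumr; apply: eq_bigr => m _.
by rewrite mcoeffZ scalerA.
Qed.

Lemma pderivD phi f g : pderiv phi (f + g) = pderiv phi f + pderiv phi g.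
Proof. by have := pderiv_lin phi 1 f g; rewrite !scale1r. Qed.

Lemma pderiv0 phi : pderiv phi 0 = 0.
Proof. by rewrite pderivE raddf0. Qed.

Lemma pderivZ phi c f : pderiv phi (c *: f) = c *: pderiv phi f.
Proof. by rewrite -[c *: f]addr0 pderiv_lin pderiv0 addr0. Qed.

Lemma mderivw phi m (d : {fset nat}) : (finsupp m `<=` d)%fset ->
  mderiv phi m = \sum_(i <- d) (m i)%:R *: (<< divcm m U_(i)%M >> * phi i).
Proof.
move=> le; rewrite /mderiv; apply/big_fset_incl => // i _.
by rewrite -cmE_eq0 => /eqP ->; rewrite scale0r.
Qed.

Lemma malgUM m1 m2 : << m1 >> * << m2 >> = << (m1 * m2)%M >> :> P.
Proof. by rewrite malgM_def fgmulUU mulr1. Qed.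

Lemma divcm_mull m1 m2 i : (0 < m1 i)%N ->
  divcm (m1 * m2)%M U_(i)%M = (divcm m1 U_(i)%M * m2)%M.
Proof.
move=> h; apply/eqP/cmP => j; rewrite divcmE !cmM divcmE cmU.
by case: eqP => [<-|_]; rewrite ?subn0 // addnBAC.
Qed.

Lemma mderivM phi m1 m2 :
  mderiv phi (m1 * m2)%M = mderiv phi m1 * << m2 >> + << m1 >> * mderiv phi m2.
Proof.
have h1 := fsubsetUl (finsupp m1) (finsupp m2).
have h2 := fsubsetUr (finsupp m1) (finsupp m2).
rewrite (mderivw phi h1) (mderivw phi h2) /mderiv mdomD.
rewrite mulr_suml.
rewrite [X in _ = _ + X]mulr_sumr.
rewrite -big_split /=.
apply: eq_bigr => i _; rewrite cmM natrD scalerDl.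
have aux (A : algType K) (c : nat) (u v w : A) : ((0 < c)%N -> u = v * w) ->
    c%:R *: u = (c%:R *: v) * w.
  have [->|h ->//] := posnP c; first by rewrite mulr0n 2!scale0r mul0r.
  by rewrite scalerAl.
congr (_ + _).
  apply: aux => h.
  rewrite (divcm_mull _ h).
  rewrite -[in LHS]malgUM.
  exact: mulrAC.
rewrite [RHS]mulrC.
apply: aux => h.
rewrite mulmC (divcm_mull _ h).
rewrite -[in LHS]malgUM.
exact: mulrAC.
Qed.

Lemma pderivU phi m : pderiv phi << m >> = mderiv phi m.
Proof. by rewrite pderivE mmapU mul1r. Qed.

Lemma pderiv_var phi i : pderiv phi (pvar i) = phi i.
Proof.
rewrite pderivU /mderiv mdomU big_seq_fset1 cmUU scale1r.
suff -> : divcm U_(i)%M U_(i)%M = 1%M :> {cmonom nat} by rewrite mul1r.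
by apply/eqP/cmP => j; rewrite divcmE subnn cm1.
Qed.

Lemma malg_sumZ f : f = \sum_(m <- msupp f) f@_m *: << m >>.
Proof.
rewrite {1}[f]monalgE; apply: eq_bigr => m _.
apply/malgP => k.
rewrite [RHS]mcoeffZ.
rewrite [LHS]mcoeffU.
rewrite [X in _ * X]mcoeffU.
by rewrite mulrnAr mulr1.
Qed.

Lemma cmonom_nat_ind (Q : {cmonom nat} -> Prop) :
  Q 1%M -> (forall i m, Q m -> Q (U_(i) * m)%M) -> forall m, Q m.
Proof.
move=> Q1 QU m; have [k] := ubnP (mdeg m).
elim: k m => [m|k IH m]; first by rewrite ltn0.
rewrite ltnS => le; have [->|mN1] := eqVneq m 1%M; first exact: Q1.
have /fset0Pn[i hi] : finsupp m != fset0.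
  apply: contra mN1 => /eqP h; apply/eqP/mdeg_eq0I.
  by rewrite mdegE h big_seq_fset0.
have mE : m = (U_(i) * divcm m U_(i))%M.
  apply/eqP/cmP => j; rewrite cmM divcmE cmU.
  case: eqP => [<-|_]; last by rewrite subn0.
  by rewrite subnKC // lt0n cmE_neq0.
rewrite mE; apply/QU/IH; apply: leq_trans le.
by rewrite [in ltnRHS]mE mdegM mdegU.
Qed.

Lemma malg_linear_ind : linear_ind (fun m => << m >> : P).
Proof.
move=> Q Qlin Qm f.
rewrite [f]malg_sumZ; elim: (enum_fset (msupp f)) => [|m s IH].
  rewrite big_nil.
  by have := Qlin (-1) _ _ (Qm 1%M) (Qm 1%M); rewrite scaleN1r addNr.
rewrite big_cons; exact: (Qlin _ _ _ (Qm m) IH).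
Qed.

Lemma pvar_ind : algebra_ind pvar.
Proof.
move=> Q Qlin Q1 QM QX; apply: malg_linear_ind => [|m]; first exact: Qlin.
elim/cmonom_nat_ind: m => [|i m Qm]; first by rewrite mpolyC1E.
rewrite -malgUM; exact: (QM _ _ (QX i) Qm).
Qed.

Lemma pderivM phi f g : pderiv phi (f * g) = pderiv phi f * g + f * pderiv phi g.
Proof.
move: f g; apply: (leibniz_from_gen malg_linear_ind); first exact: pderiv_lin.
move=> m1 m2; transitivity (mderiv phi (m1 * m2)%M).
  rewrite malgUM; exact: pderivU.
rewrite mderivM.
exact: (congr2 (fun a b => a * << m2 >> + << m1 >> * b)
               (esym (pderivU phi m1)) (esym (pderivU phi m2))).
Qed.

Lemma eq_pderiv phi psi : phi =1 psi -> pderiv phi =1 pderiv psi.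
Proof.
move=> h f; apply: eq_bigr => m _.
have -> // : mderiv phi m = mderiv psi m.
by apply: eq_bigr => i _; rewrite h.
Qed.

Lemma pderiv_argD phi psi f :
  pderiv (fun i => phi i + psi i) f = pderiv phi f + pderiv psi f.
Proof.
rewrite -big_split /=; apply: eq_bigr => m _; rewrite -scalerDr.
have -> // : mderiv (fun i => phi i + psi i) m = mderiv phi m + mderiv psi m.
by rewrite -big_split /=; apply: eq_bigr => i _; rewrite mulrDr scalerDr.
Qed.

Lemma pderiv_argM phi g f : pderiv (fun i => g * phi i) f = g * pderiv phi f.
Proof.
rewrite [RHS]mulr_sumr; apply: eq_bigr => m _.
have -> : mderiv (fun i => g * phi i) m = g * mderiv phi m.
  rewrite [RHS]mulr_sumr; apply: eq_bigr => i _.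
  have CA (A : comAlgType K) (c : K) (x y z : A) :
      c *: (x * (y * z)) = y * (c *: (x * z)) by rewrite mulrCA scalerAr.
  exact: CA.
exact: scalerAr.
Qed.

Lemma pderiv_argZ phi c f : pderiv (fun i => c *: phi i) f = c *: pderiv phi f.
Proof.
rewrite -[RHS]mul_malgC -pderiv_argM; apply: eq_pderiv => i.
exact: esym (mul_malgC c (phi i)).
Qed.

End PolynomialDerivation.

Section FreePoisson.
Variables (K : fieldType) (n : nat).
Implicit Type B : free_lie_basis K n.

Definition free_poisson B : Type := {malg K[{cmonom nat}]}.

HB.instance Definition _ B := GRing.ComAlgebra.on (free_poisson B).

(* The linear embedding L -> P sending the basis element e_k to the variable. *)
Definition of_lie B (u : fl_lie B) : free_poisson B :=
  lincomb (@pvar K) (xchoose ((fl_basisP B).2 u)).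

(* {f, g} = sum over i, j of (df/de_i) (dg/de_j) [e_i, e_j], which is the only *)
(* Poisson bracket extending [e_i, e_j] (see br_var and br_jacobi below).     *)
Definition fp_bracket B (f g : free_poisson B) : free_poisson B :=
  pderiv (fun i => pderiv (fun j =>
    of_lie (lie (fl_basis B i) (fl_basis B j))) g) f.

Section Laws.
Variable B : free_lie_basis K n.
Local Notation e := (fl_basis B).
Local Notation P := (free_poisson B).
Local Notation X := (@pvar K).
Local Notation br := (@fp_bracket B).
Implicit Types (f g h : P) (u v : fl_lie B).

Lemma of_lieE s : of_lie (lincomb e s) = lincomb X s.
Proof.
rewrite /of_lie; have /eqP/esym := xchooseP ((fl_basisP B).2 (lincomb e s)).
set t := xchoose _ => tE.
have [r rE] := lincomb_lin (-1) t s.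
have r0 : lincomb e r = 0 by rewrite rE tE scaleN1r addNr.
have : lincomb X r = 0.
  apply: big1 => i _; rewrite ((fl_basisP B).1 r r0 i); exact: scale0r.
by rewrite rE scaleN1r addrC => /eqP; rewrite subr_eq0 => /eqP.
Qed.

Lemma of_lie_lin c u v : of_lie (c *: u + v) = c *: of_lie u + of_lie v.
Proof.
have [s /eqP uE] := (fl_basisP B).2 u; have [t /eqP vE] := (fl_basisP B).2 v.
have [r rE] := lincomb_lin c s t.
by rewrite uE vE -rE !of_lieE rE.
Qed.

Lemma of_lie0 : of_lie (0 : fl_lie B) = 0.
Proof.
have -> : 0 = lincomb e [::] :> fl_lie B by rewrite /lincomb big_ord0.
by rewrite of_lieE /lincomb big_ord0.
Qed.

Lemma of_lieD u v : of_lie (u + v) = of_lie u + of_lie v.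
Proof. by have := of_lie_lin 1 u v; rewrite !scale1r. Qed.

Lemma of_lie_basis k : of_lie (e k) = X k.
Proof.
pose s : seq K := rcons (nseq k 0) 1.
have sE (W : lmodType K) (f : nat -> W) : lincomb f s = f k.
  rewrite /lincomb size_rcons size_nseq big_ord_recr /= big1 => [|i _].
    by rewrite nth_rcons size_nseq ltnn eqxx scale1r add0r.
  by rewrite nth_rcons size_nseq ltn_ord nth_nseq ltn_ord scale0r.
by rewrite -(sE _ e) of_lieE sE.
Qed.

Lemma brDl c f g h : br (c *: f + g) h = c *: br f h + br g h.
Proof. exact: pderiv_lin. Qed.

Lemma brDr c f g h : br h (c *: f + g) = c *: br h f + br h g.
Proof.
rewrite /fp_bracket -pderiv_argZ -pderiv_argD; apply: eq_pderiv => i.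
exact: pderiv_lin.
Qed.

Lemma brMl f g h : br (f * g) h = br f h * g + f * br g h.
Proof. exact: pderivM. Qed.

Lemma brMr f g h : br h (f * g) = f * br h g + br h f * g.
Proof.
rewrite [br h f * g]mulrC /fp_bracket -!pderiv_argM -pderiv_argD.
apply: eq_pderiv => i.
have AC (A : comAlgType K) (a b c d : A) : a * b + c * d = c * d + b * a.
  by rewrite addrC [b * a]mulrC.
exact: etrans (pderivM _ f g) (AC _ _ _ _ _).
Qed.

Lemma br0r f : br f 0 = 0.
Proof. by have := brDr (-1) 0 0 f; rewrite scaler0 addr0 scaleN1r addNr. Qed.

Lemma br_var i j : br (X i) (X j) = of_lie (lie (e i) (e j)).
Proof. by rewrite /fp_bracket !pderiv_var. Qed.

Lemma lieDl (L : lieAlgType K) (x y z : L) : lie (x + y) z = lie x z + lie y z.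
Proof. by have := lie_linearl (1 : K) x y z; rewrite !scale1r. Qed.

Lemma lieDr (L : lieAlgType K) (x y z : L) : lie z (x + y) = lie z x + lie z y.
Proof. by have := lie_linearr (1 : K) x y z; rewrite !scale1r. Qed.

Lemma lieC (L : lieAlgType K) (x y : L) : lie x y = - lie y x.
Proof.
apply/eqP; rewrite -addr_eq0; have := liexx (x + y).
by rewrite lieDl !lieDr !liexx add0r addr0 => ->.
Qed.

Let of_lieN u : of_lie (- u) = - of_lie u.
Proof.
by rewrite -scaleN1r -[_ *: u]addr0 of_lie_lin of_lie0 addr0 scaleN1r.
Qed.

Let brC_var i j : br (X i) (X j) = - br (X j) (X i).
Proof.
apply: etrans (br_var i j) _; rewrite lieC of_lieN.
exact: (congr1 -%R (esym (br_var j i))).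
Qed.

Lemma brxx f : br f f = 0.
Proof.
apply: (brxx_from_gen (@pvar_ind K) brDl brDr brMl brMr brC_var) => i.
by rewrite br_var liexx of_lie0.
Qed.

Lemma br_var_lie i u : br (X i) (of_lie u) = of_lie (lie (e i) u).
Proof.
have [s /eqP ->] := (fl_basisP B).2 u; rewrite of_lieE /lincomb.
elim: (index_enum _) => [|k r IH].
  rewrite 2!big_nil br0r; apply: esym; apply: etrans of_lie0; congr of_lie.
  by apply: (addrI (lie (e i) 0)); rewrite -lieDr !addr0.
rewrite 2!big_cons lie_linearr of_lie_lin -IH -br_var; exact: brDr.
Qed.

Lemma br_jacobi f g h : br f (br g h) + br g (br h f) + br h (br f g) = 0.
Proof.
move: f g h.
apply: (jacobi_from_gen (@pvar_ind K) brDl brDr brMl brMr brC_var) => i j k.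
have E a b c : br (X a) (br (X b) (X c)) = of_lie (lie (e a) (lie (e b) (e c))).
  exact: etrans (congr1 (br (X a)) (br_var b c)) (br_var_lie a _).
apply: etrans (congr2 +%R (congr2 +%R (E i j k) (E j k i)) (E k i j)) _.
by rewrite -2!of_lieD lie_jacobi of_lie0.
Qed.

End Laws.

HB.instance Definition _ B := Lmodule_isLieAlgebra.Build K (free_poisson B)
  (@brDl B) (@brDr B) (@brxx B) (@br_jacobi B).
HB.instance Definition _ B := LieAlgebra_isPoisson.Build K (free_poisson B)
  (fun f g h => @brMr B g h f).

Section Grading.
Variable B : free_lie_basis K n.
Implicit Types (f : free_poisson B) (m : {cmonom nat}).

Definition fp_gen (i : 'I_n) : free_poisson B := of_lie (fl_gen B i).

Definition fp_mdeg m : nat := \sum_(k <- finsupp m) m k * fl_deg B k.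

Definition fp_homogeneous (k : nat) f : bool :=
  all (fun m => fp_mdeg m == k) (msupp f).

(* The component P_i of the Z/d-grading, i being read modulo d; it is the     *)
(* span of the homogeneous elements of degree = i mod d by fp_componentP.     *)
Definition fp_component (d i : nat) : {pred free_poisson B} :=
  fun f => all (fun m => fp_mdeg m == i %[mod d]) (msupp f).

Definition veronese (d : nat) : {pred free_poisson B} := fp_component d 0.

Lemma fp_componentP (d i : nat) f :
  f \in fp_component d i <->
  exists2 s : seq (free_poisson B),
    (forall g, g \in s -> exists2 k, k = i %[mod d] & fp_homogeneous k g)
    & f = \sum_(g <- s) g.
Proof.
split=> [/allP fi|[s hs ->]].
  exists [seq << f@_m *g m >> | m <- msupp f]; last by rewrite big_map -monalgE.
  move=> g /mapP[m mf ->]; exists (fp_mdeg m); first exact/eqP/fi.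
  by apply/allP => m' /(fsubsetP msuppU_le); rewrite inE => /eqP ->.
elim: s hs => [|g s IH] hs; first by rewrite big_nil /in_mem /= /fp_component msupp0.
rewrite big_cons; apply/allP => m /(fsubsetP (msuppD_le _ _)).
rewrite in_fsetU => /orP[mg|ms].
  have [k ki /allP hg] := hs g (mem_head _ _).
  by rewrite (eqP (hg m mg)) ki.
have /allP := IH (fun g' h => hs g' (@mem_behead _ (g :: s) g' h)); exact.
Qed.

Definition d_graded (d : nat) (D : free_poisson B -> free_poisson B) : Prop :=
  forall i : 'I_n, D (fp_gen i) \in fp_component d 1.

End Grading.
End FreePoisson.

(* Main.v *)
(* Let y, z be two variables of degree 1. If D lifts D0 and f is a monomial,  *)
(* then logarithmic differentiation of y^r f, with r + deg f = 0 mod d, gives *)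
(*   d y^(r+d) D f = d y^d D0(y^r f) - r y^r f D0(y^d).                       *)
(* Since (y^r f)^d (z^d)^r = (z^r f)^d (y^d)^r is a relation inside P_0, the  *)
(* right-hand side N_y satisfies z^(r+d) N_y = y^(r+d) N_z, hence is          *)
(* divisible by y^(r+d) and D f is a polynomial. The defect                   *)
(* D{f,g} - {Df,g} - {f,Dg} is a derivation in each argument that vanishes on *)
(* P_0; such a derivation T is zero because 0 = T(f^d) = d f^(d-1) T f for    *)
(* f homogeneous. Finally, if f is homogeneous then D(f^d) = d f^(d-1) D f    *)
(* shows that (D f)^d has smaller order of nilpotency than f^d, so D is       *)
(* nilpotent on f by induction.                                               *)

From HB Require Import structures.
Require Import Defs.
From mathcomp Require Import all_boot all_algebra.
From mathcomp Require Import finmap ring zify.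
From mathcomp.multinomials Require Import monalg.

Set Implicit Arguments.
Unset Strict Implicit.
Unset Printing Implicit Defensive.

Import GRing.Theory.
Local Open Scope ring_scope.

Local Notation "1" := (@mone _) : monom_scope.
Local Notation "x * y" := (mmul x y) : monom_scope.
Local Notation "'U_(' i )" := (@ucm _ i) : monom_scope.

(** P_0 determines logarithmic derivatives on all of P. If y is a variable of degree 1, every
    monomial enters P_0 after multiplication by a power of y, and y^d is in P_0; so D0 prescribes D
    f / f for any lift D, a priori with a power of y as denominator. Since n >= 2 there is a second
    variable z of degree 1, and the same fraction has a power of z as denominator, hence it is
    polynomial ([logder_cross], [pvar_coprime], [loglift_exists]).

    Prescribing these values at the variables defines [veronese_lift]. Additivity of logarithmic
    derivatives ([lift_mon]) shows that it extends D0 ([lift_veronese]) and preserves the grading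
    ([lift_component]). Compatibility with the bracket ([lift_lie]) and local nilpotency
    ([lift_nilpotent]) are carried over from P_0 through d-th powers of homogeneous elements.

    The structural input is that P is a domain ([malg_domain]), that the bracket respects the
    grading ([component_lie]), and that every homogeneous basis contains two distinct elements of
    degree 1 ([degree1_basis]). *)

Section AssociativeDerivations.
Variables (K : fieldType) (R : comAlgType K).
Hypothesis K0 : [pchar K] =i pred0.
Hypothesis domR : forall a b : R, a * b = 0 -> (a == 0) || (b == 0).

Lemma mul_neq0 (a b : R) : a != 0 -> b != 0 -> a * b != 0.
Proof. by move=> a0 b0; apply/eqP => /domR; rewrite (negPf a0) (negPf b0). Qed.

Lemma exp_neq0 (a : R) k : a != 0 -> a ^+ k != 0.
Proof.
by move=> a0; elim: k => [|k IH]; rewrite ?oner_neq0 // exprS mul_neq0.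
Qed.

Lemma mul_cancel (a b c : R) : a != 0 -> a * b = a * c -> b = c.
Proof.
move=> a0 /eqP; rewrite -subr_eq0 -mulrBr => /eqP /domR.
by rewrite (negPf a0) subr_eq0 => /eqP.
Qed.

Lemma natr_neq0 k : (0 < k)%N -> k%:R != 0 :> R.
Proof.
move=> k0; rewrite -scaler_nat scaler_eq0 oner_eq0 orbF ((pcharf0P K).1 K0).
by rewrite -lt0n.
Qed.

(** * Logarithmic derivatives for a product rule valid on a subset only *)

Section OnSubset.
Variables (S : {pred R}) (D : R -> R).
Hypothesis S1 : 1 \in S.
Hypothesis SM : {in S &, forall a b, a * b \in S}.
Hypothesis DM : {in S &, forall a b, D (a * b) = D a * b + a * D b}.

Lemma subset_exp a k : a \in S -> a ^+ k \in S.
Proof. by move=> Sa; elim: k => [|k IH]; rewrite ?expr0 // exprS SM. Qed.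

Lemma der1 : D 1 = 0.
Proof.
have := DM S1 S1; rewrite !mulr1 mul1r => h.
by apply: (addrI (D 1)); rewrite -h addr0.
Qed.

(** The power rule multiplied by [a], which avoids the exponent k - 1. *)
Lemma derX a k : a \in S -> a * D (a ^+ k) = k%:R * a ^+ k * D a.
Proof.
move=> Sa; elim: k => [|k IH]; first by rewrite der1 mulr0 !mul0r.
rewrite exprS DM ?subset_exp // mulrDr mulrCA [a * D _]mulrC -mulrA.
by rewrite [D _ * a]mulrC IH mulrS; ring.
Qed.

(* Logarithmic differentiation of (y^r f)^d (z^d)^r = (z^r f)^d (y^d)^r.      *)
Lemma logder_cross (d r : nat) (y z f : R) :
  y != 0 -> z != 0 -> f != 0 ->
  y ^+ d \in S -> z ^+ d \in S -> y ^+ r * f \in S -> z ^+ r * f \in S ->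
  z ^+ (r + d) * (d%:R * y ^+ d * D (y ^+ r * f)
                  - r%:R * (y ^+ r * f) * D (y ^+ d)) =
  y ^+ (r + d) * (d%:R * z ^+ d * D (z ^+ r * f)
                  - r%:R * (z ^+ r * f) * D (z ^+ d)).
Proof.
move=> y0 z0 f0; set Y := y ^+ d; set Z := z ^+ d.
set A := y ^+ r * f; set B := z ^+ r * f => SY SZ SA SB.
have TE : A ^+ d * Z ^+ r = B ^+ d * Y ^+ r.
  by rewrite /A /B !exprMn -!exprM [(d * r)%N]mulnC; ring.
have T0 : A ^+ d * Z ^+ r != 0.
  by rewrite mul_neq0 ?exp_neq0 ?mul_neq0 ?exp_neq0.
(* Logarithmic derivative of a^d b^r with denominators cleared, to be applied to both sides of
   [TE]. *)
have key a b : a \in S -> b \in S -> a * b * D (a ^+ d * b ^+ r) =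
    a ^+ d * b ^+ r * (d%:R * b * D a + r%:R * a * D b).
  move=> Sa Sb; rewrite DM ?subset_exp //.
  transitivity (a * D (a ^+ d) * (b * b ^+ r) + b * D (b ^+ r) * (a * a ^+ d)).
    by ring.
  by rewrite !derX //; ring.
have E : B * Y * (d%:R * Z * D A + r%:R * A * D Z)
         = A * Z * (d%:R * Y * D B + r%:R * B * D Y).
  apply: (mul_cancel T0).
  rewrite mulrCA -key // [X in _ = X]mulrCA {2}TE -[in RHS]key // TE; ring.
(* Multiplied by [f], the goal becomes [E], because f y^r = A and f z^r = B. *)
apply: (mul_cancel f0); apply/eqP; rewrite -subr_eq0; apply/eqP.
move/eqP: E; rewrite -subr_eq0 => /eqP E; rewrite -[RHS]E.
by rewrite !exprD -/Y -/Z /A /B; ring.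
Qed.

(* Denominator-free form of                                                   *)
(* h / f = D (y^r f) / (y^r f) - (r / d) D (y^d) / y^d.                       *)
Definition loglift (d : nat) (y : R) (r : nat) (f h : R) : Prop :=
  d%:R * y ^+ (r + d) * h =
  d%:R * y ^+ d * D (y ^+ r * f) - r%:R * (y ^+ r * f) * D (y ^+ d).

Lemma loglift1 d y : loglift d y 0 1 0.
Proof. by rewrite /loglift expr0 mulr1 der1 !mulr0 !mul0r subr0. Qed.

(** Logarithmic derivatives add under products, and so do the exponents of y. *)
Lemma logliftM d y r s f g h k : y ^+ r * f \in S -> y ^+ s * g \in S ->
  loglift d y r f h -> loglift d y s g k ->
  loglift d y (r + s) (f * g) (h * g + f * k).
Proof.
move=> Sf Sg Lf Lg; rewrite /loglift.
transitivity (y ^+ s * g * (d%:R * y ^+ (r + d) * h)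
              + y ^+ r * f * (d%:R * y ^+ (s + d) * k)).
  by rewrite !exprD; ring.
rewrite Lf Lg natrD.
have -> : y ^+ (r + s) * (f * g) = y ^+ r * f * (y ^+ s * g).
  by rewrite exprD; ring.
by rewrite (DM Sf Sg); ring.
Qed.

(** Here the factor y^(d s) is a power of y^d and lies in S itself, so the correction term cancels
    its logarithmic derivative and only that of [f] remains. *)
Lemma loglift_subset d y s f h : (0 < d)%N -> y != 0 ->
  y ^+ d \in S -> f \in S -> loglift d y (d * s) f h -> h = D f.
Proof.
move=> d0 y0 SY Sf; rewrite /loglift exprD exprM.
have -> : D ((y ^+ d) ^+ s * f) = D ((y ^+ d) ^+ s) * f + (y ^+ d) ^+ s * D f.
  exact/DM/Sf/subset_exp.
set Y := y ^+ d => L; have Y0 : Y != 0 by apply: exp_neq0.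
apply: (@mul_cancel (d%:R * Y ^+ s * Y)).
  by rewrite !mul_neq0 ?exp_neq0 ?natr_neq0.
transitivity (d%:R * (Y ^+ s * Y) * h); first by ring.
rewrite L natrM.
transitivity (d%:R * f * (Y * D (Y ^+ s)) + d%:R * Y ^+ s * Y * D f
              - d%:R * s%:R * (Y ^+ s * f) * D Y); first by ring.
by rewrite derX //; ring.
Qed.

End OnSubset.

(** * Order of nilpotency of a derivation of a domain *)

Section Total.
Variable D : R -> R.
Hypothesis DD : {morph D : a b / a + b}.
Hypothesis DM : forall a b, D (a * b) = D a * b + a * D b.

Let D0 : D 0 = 0.
Proof. by apply: (addrI (D 0)); rewrite -DD !addr0. Qed.

Lemma iter_der0 k : iter k D 0 = 0.
Proof. by elim: k => //= k ->. Qed.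

Lemma iter_derD k : {morph iter k D : a b / a + b}.
Proof. by move=> a b; elim: k => //= k ->. Qed.

Let DX a k : a * D (a ^+ k) = k%:R * a ^+ k * D a.
Proof. exact: (@derX predT D). Qed.

Lemma der_exp_eq0 a k : (0 < k)%N -> D (a ^+ k) = 0 -> D a = 0.
Proof.
move=> k0 h; have [->|a0] := eqVneq a 0; first exact: D0.
have /esym := DX a k; rewrite h mulr0 => /domR.
by rewrite (negPf (mul_neq0 (natr_neq0 k0) (exp_neq0 k a0))) => /eqP.
Qed.

Definition nilorder k a : Prop := iter k D a != 0 /\ iter k.+1 D a = 0.

Lemma nilorder_inj k l a : nilorder k a -> nilorder l a -> k = l.
Proof.
wlog lt : k l / (k < l)%N.
  by move=> W hk hl; case: (ltngtP k l) => // /W ->.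
move=> [_ k0] [/eqP[]]; rewrite -(subnK lt) iterD k0; exact: iter_der0.
Qed.

Lemma nilorder_exists a m : a != 0 -> iter m D a = 0 -> exists k, nilorder k a.
Proof.
move=> a0; elim: m => [/= h|m IH h]; first by rewrite h eqxx in a0.
by have [/IH //|hm] := eqVneq (iter m D a) 0; exists m.
Qed.

(** In the Leibniz expansion every other term differentiates [a] more than k times or [b] more than
    l times. *)
Lemma iter_derM k l a b : iter k.+1 D a = 0 -> iter l.+1 D b = 0 ->
  iter (k + l) D (a * b) = 'C(k + l, k)%:R * (iter k D a * iter l D b).
Proof.
move: {2}(k + l)%N (erefl (k + l)%N) => m; elim: m k l a b => [|m IH] k l a b.
  by move/eqP; rewrite addn_eq0 => /andP[/eqP-> /eqP->] _ _ /=; rewrite mul1r.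
move=> klm ka lb; rewrite klm iterSr DM iter_derD.
case: k l klm ka lb => [|k] [|l] // klm ka lb.
- rewrite (_ : D a = 0) // mul0r iter_der0 add0r.
  case: klm => klm; subst m; have := IH 0%N l a (D b) (erefl _) ka.
  by rewrite -!iterSr !bin0 => ->.
- rewrite (_ : D b = 0) // mulr0 iter_der0 addr0.
  case: klm; rewrite addn0 => klm; subst m; have := IH k 0%N (D a) b.
  by rewrite !addn0 -!iterSr !binn => ->.
case: klm => klm; have E1 := IH k l.+1 (D a) b; have E2 := IH k.+1 l a (D b).
rewrite -iterSr in E1; rewrite -iterSr addSnnS in E2; rewrite klm in E1 E2.
rewrite E1 ?E2 // -!iterSr binS natrD; ring.
Qed.

(** The surviving term of [iter_derM] is nonzero in a domain of characteristic zero, so the order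
    behaves like a degree. *)
Lemma nilorderM k l a b :
  nilorder k a -> nilorder l b -> nilorder (k + l) (a * b).
Proof.
move=> [ka ka0] [lb lb0]; rewrite /nilorder /= iter_derM //; split.
  by rewrite !mul_neq0 // natr_neq0 // bin_gt0 leq_addr.
have E : iter (k + l).+1 D (a * b)
         = 'C(k + l, k)%:R * D (iter k D a * iter l D b).
  rewrite iterS iter_derM //.
  elim: ('C(_, _)) => [|c IH]; first by rewrite !mul0r D0.
  by rewrite !mulrS !mulrDl !mul1r DD IH.
rewrite iterS iter_derM // in E; rewrite E DM -!iterS ka0 lb0.
by rewrite mul0r mulr0 addr0 mulr0.
Qed.

Lemma nilorderX k m a : nilorder k a -> nilorder (m * k) (a ^+ m).
Proof.
move=> ka; elim: m => [|m IH]; last by rewrite exprS mulSn; apply: nilorderM.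
by split; rewrite /= ?oner_neq0 //; apply: (@der1 predT D).
Qed.

Lemma nilorder_nat c : (0 < c)%N -> nilorder 0 c%:R.
Proof.
move=> c0; split; first exact: natr_neq0.
elim: c {c0} => [|c IH] /=; first exact: D0.
by rewrite mulrS DD (@der1 predT D) // add0r.
Qed.

(* If f^d has order N > 0, then D (f^d) = d f^(d-1) D f forces (D f)^d to     *)
(* have order N - d.                                                          *)
Lemma nilpotent_of_power (T : {pred R}) (d : nat) : (0 < d)%N ->
  {in T, forall f, D f \in T} ->
  {in T, forall f, exists m, iter m D (f ^+ d) = 0} ->
  {in T, forall f, exists m, iter m D f = 0}.
Proof.
move=> d0 TD Tnil f Tf.
have [->|f0] := eqVneq f 0; first by exists 0%N.
have [m fm] := Tnil f Tf; have [k] := nilorder_exists (exp_neq0 d f0) fm.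
elim/ltn_ind: k f Tf f0 {m fm} => k IH f Tf f0 ordf.
have [Df0|Df0] := eqVneq (D f) 0; first by exists 1%N.
have [m Dfm] := Tnil _ (TD f Tf).
have [l ordDf] := nilorder_exists (exp_neq0 d Df0) Dfm.
suff [p hp] : exists p, iter p D (D f) = 0 by exists p.+1; rewrite iterSr.
apply: (IH l) => //; last exact: TD.
case: k ordf {IH} => [[_ /(der_exp_eq0 d0)]|k ordf]; first by move/eqP: Df0.
have ordDg : nilorder k (D (f ^+ d)).
  by case: ordf => h1 h2; rewrite /nilorder -!iterSr.
have ord1 := nilorderM ordf (nilorderX d ordDg).
have ord2 : nilorder (0 + (d * k.+1 + l))
    ((d ^ d)%:R * ((f ^+ d) ^+ d * D f ^+ d)).
  apply: nilorderM; first by apply: nilorder_nat; rewrite expn_gt0 d0.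
  by apply: nilorderM => //; apply: nilorderX.
have E : f ^+ d * D (f ^+ d) ^+ d = (d ^ d)%:R * ((f ^+ d) ^+ d * D f ^+ d).
  by rewrite -exprMn DX !exprMn natrX mulrA.
(* The two orders give (k + 1) + d k = d (k + 1) + l, that is l = k + 1 - d < k + 1. *)
rewrite E in ord1; have := nilorder_inj ord1 ord2; move: d0 {E}; clear.
rewrite mulnS add0n; move: (d * k)%N => dk; lia.
Qed.

End Total.
End AssociativeDerivations.

(** * Failure of a derivation of the product to respect the bracket *)

Section LieDefect.
Variables (K : fieldType) (P : poissonAlgType K) (D : P -> P).
Hypothesis Dlin : forall c f g, D (c *: f + g) = c *: D f + D g.
Hypothesis DM : forall f g, D (f * g) = D f * g + f * D g.

Definition lie_defect (f g : P) : P :=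
  D (lie f g) - (lie (D f) g + lie f (D g)).

Lemma lie_defect_linr f c g h :
  lie_defect f (c *: g + h) = c *: lie_defect f g + lie_defect f h.
Proof.
rewrite /lie_defect Dlin !lie_linearr Dlin [X in _ - X]addrACA opprD addrACA.
by rewrite -scalerDr -scalerBr.
Qed.

(** [lie_defect f] is the operator [D, ad f] - ad (D f), built from derivations of the product by a
    commutator and a difference. *)
Lemma lie_defectMr f g h :
  lie_defect f (g * h) = lie_defect f g * h + g * lie_defect f h.
Proof.
have DD : {morph D : a b / a + b}.
  by move=> a b; have := Dlin 1 a b; rewrite !scale1r.
by rewrite /lie_defect lie_leibniz DM DD lieDr !lie_leibniz !DM; ring.
Qed.

Lemma lie_defectC f g : lie_defect f g = - lie_defect g f.
Proof.
have DN a : D (- a) = - D a.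
  have D0 : D 0 = 0 by have := Dlin (-1) 0 0; rewrite !scaleN1r !addNr.
  by have := Dlin (-1) a 0; rewrite !scaleN1r D0 !addr0.
rewrite /lie_defect (lieC f g) DN (lieC (D f)) (lieC f) opprB; ring.
Qed.

End LieDefect.

(** * Weights on monomials *)

Section CommutativeMonomials.
Implicit Types (m : {cmonom nat}) (w : nat -> nat).

(** Serves both as the degree [fp_mdeg], with [w] equal to [fl_deg B], and as the exponent in
    Kronecker substitution. *)
Definition cmweight w m : nat := \sum_(i <- finsupp m) m i * w i.

Lemma cmweightw w m (D : {fset nat}) : (finsupp m `<=` D)%fset ->
  cmweight w m = (\sum_(i <- D) m i * w i)%N.
Proof.
move=> le; rewrite /cmweight; apply/big_fset_incl => // i _.
by rewrite -cmE_eq0 => /eqP ->; rewrite mul0n.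
Qed.

Lemma cmweightM w m1 m2 :
  cmweight w (m1 * m2)%M = (cmweight w m1 + cmweight w m2)%N.
Proof.
rewrite (cmweightw w (fsubsetUl (finsupp m1) (finsupp m2))).
rewrite (cmweightw w (fsubsetUr (finsupp m1) (finsupp m2))).
rewrite /cmweight mdomD -big_split /=; apply: eq_bigr => i _.
by rewrite cmM mulnDl.
Qed.

Lemma cmweight1 w : cmweight w 1%M = 0%N.
Proof. by rewrite /cmweight mdom1 big_seq_fset0. Qed.

Lemma cmweightU w i : cmweight w U_(i)%M = w i.
Proof. by rewrite /cmweight mdomU big_seq_fset1 cmUU mul1n. Qed.

Lemma digits_inj (b N : nat) (u v : nat -> nat) :
  (forall i, u i < b)%N -> (forall i, v i < b)%N ->
  (\sum_(i < N) u i * b ^ i = \sum_(i < N) v i * b ^ i)%N ->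
  forall i, (i < N)%N -> u i = v i.
Proof.
elim: N u v => [//|N IH] u v ub vb; have b0 := leq_ltn_trans (leq0n _) (ub 0%N).
have tail (t : nat -> nat) : (\sum_(i < N) t (lift ord0 i) * b ^ lift ord0 i
    = (\sum_(i < N) t i.+1 * b ^ i) * b)%N.
  by rewrite big_distrl; apply: eq_bigr => i _ /=; rewrite -mulnA -expnSr.
rewrite !big_ord_recl /= !tail !expn0 !muln1 => E.
have E0 : u 0%N = v 0%N.
  have := congr1 (modn^~ b) E.
  by rewrite ![(_ 0 + _)%N]addnC !modnMDl !modn_small.
case=> [//|i]; rewrite ltnS => iN.
apply: (IH (fun i => u i.+1) (fun i => v i.+1)) iN => //.
by move/eqP: E; rewrite E0 eqn_add2l eqn_pmul2r // => /eqP.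
Qed.

Lemma cm_bound m : exists N, forall i, (m i < N)%N /\ (N <= i -> m i = 0)%N.
Proof.
exists (\max_(i <- finsupp m) maxn (m i) i).+1 => i.
have [im|im] := boolP (i \in finsupp m); last first.
  by rewrite -cmE_eq0 in im; rewrite (eqP im).
have := leq_bigmax_seq (F := fun i => maxn (m i) i) _ im isT.
by rewrite geq_max => /andP[mi iN]; split=> //; rewrite ltnNge iN.
Qed.

Lemma cm_bounds (s : seq {cmonom nat}) : exists N, {in s, forall m i,
  (m i < N)%N /\ (N <= i -> m i = 0)%N}.
Proof.
elim: s => [|m s [N IH]]; first by exists 0%N.
have [M hM] := cm_bound m; exists (maxn M N) => m' /[!inE] /orP[/eqP->|m's] i.
  by split=> [|h]; [rewrite leq_max (hM i).1|apply: (hM i).2; lia].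
have [h1 h2] := IH m' m's i.
by split=> [|h]; [rewrite leq_max h1 orbT|apply: h2; lia].
Qed.

(** With N above all exponents and indices occurring in [s], the weights N^i read a monomial as a
    number in base N. *)
Lemma cmweight_inj (s : seq {cmonom nat}) :
  exists w, {in s &, injective (cmweight w)}.
Proof.
have [N hN] := cm_bounds s; exists (expn N).
have sumE m : m \in s -> cmweight (expn N) m = (\sum_(i < N) m i * N ^ i)%N.
  move=> ms; rewrite (@cmweightw _ m [fset i in iota 0 N]%fset).
    rewrite -(big_mkord xpredT (fun i => m i * N ^ i)%N) /index_iota subn0.
    apply/perm_big/uniq_perm; [exact: fset_uniq|exact: iota_uniq|].
    by move=> i; rewrite inE.
  apply/fsubsetP => i; rewrite !inE mem_iota /= add0n ltnNge -cmE_neq0.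
  by apply: contra => /(hN m ms i).2 ->.
move=> m1 m2 m1s m2s; rewrite !sumE // => E; apply/eqP/cmP => i.
have [iN|Ni] := ltnP i N; last by rewrite !(hN _ _ _).2.
by apply: (digits_inj _ _ E) => // j; apply: (hN _ _ _).1.
Qed.
End CommutativeMonomials.

(** * The polynomial algebra is a domain *)

Section PolynomialDomain.
Variable K : fieldType.
Local Notation P := {malg K[{cmonom nat}]}.

(* Kronecker substitution of powers t^(w i) for the variables.                *)
Section Kronecker.
Variable w : nat -> nat.
Definition wmon (m : {cmonom nat}) : {poly K} := 'X^(cmweight w m).

Lemma wmon_mult : mmorphism wmon.
Proof. by split=> [m1 m2|]; rewrite /wmon ?cmweight1 // cmweightM exprD. Qed.

HB.instance Definition _ := isMultiplicative.Build _ _ wmon wmon_mult.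

Lemma kronM (f g : P) :
  mmap polyC wmon (f * g) = mmap polyC wmon f * mmap polyC wmon g.
Proof. exact: rmorphM. Qed.
End Kronecker.

(** No two monomials of [f] collide, so each coefficient of [f] can be read off its image. *)
Lemma kron_eq0 w (f : P) : {in msupp f &, injective (cmweight w)} ->
  mmap polyC (wmon w) f = 0 -> f = 0.
Proof.
move=> winj h; apply/eqP; rewrite -msupp_eq0.
apply/negPn/negP => /fset0Pn[m mf].
have := congr1 (fun p : {poly K} => p`_(cmweight w m)) h.
rewrite coef0 /mmap coef_sum (big_fsetD1 m mf) big_seq_cond /= big1 => [|m'].
  rewrite addr0 coefCM coefXn eqxx mulr1 => /eqP.
  by rewrite mcoeff_eq0 mf.
rewrite andbT in_fsetD1 coefCM coefXn => /andP[m'm m'f].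
case: eqVneq => [/winj E|_]; last by rewrite mulr0.
by rewrite E ?eqxx in m'm.
Qed.

Lemma malg_domain (f g : P) : f * g = 0 -> (f == 0) || (g == 0).
Proof.
move=> fg0; have [w winj] := cmweight_inj (msupp f ++ msupp g).
have := kronM w f g; rewrite fg0 mmap0 => /esym/eqP; rewrite mulf_eq0.
by case/orP=> /eqP /kron_eq0 -> //; rewrite ?eqxx ?orbT // => m1 m2 h1 h2;
  apply: winj; rewrite mem_cat ?h1 ?h2 ?orbT.
Qed.

End PolynomialDomain.

(** * Divisibility by monomials *)

Section MonomialDivision.
Variable K : fieldType.
Local Notation P := {malg K[{cmonom nat}]}.
Implicit Types (f g h : P) (m : {cmonom nat}).

Lemma mmulI m m1 m2 : (m * m1)%M = (m * m2)%M -> m1 = m2.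
Proof.
move=> E; apply/eqP/cmP => i; have := congr1 (fun k : {cmonom nat} => k i) E.
by rewrite !cmM => /addnI.
Qed.

Lemma mcoeffUg m m' g : (<< m >> * g)@_(m * m')%M = g@_m'.
Proof.
rewrite [X in X@_ _]malgM_def fgmulUg raddf_sum /=.
rewrite (eq_bigr (fun k => g@_k *+ (k == m'))) => [|k _].
  rewrite [in RHS](monalgE g) raddf_sum /=; apply: eq_bigr => k _.
  by rewrite mcoeffU.
rewrite mcoeffU (mul1r g@_k); congr (_ *+ nat_of_bool _).
by apply/eqP/eqP => [/mmulI|->].
Qed.

(** For each monomial m of [f], the monomial a divides b m; as a and b share no variable, a divides
    m. *)
Lemma monomial_divides (a b : {cmonom nat}) (p q f g : P) :
  p = << a >> -> q = << b >> -> (forall i, a i = 0 \/ b i = 0)%N ->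
  q * f = p * g -> exists h, f = p * h.
Proof.
move=> -> -> ab E; have le m i : m \in msupp f -> (a i <= m i)%N.
  move=> mf; have [->//|bi] := ab i.
  have : (b * m)%M \in msupp (<< a >> * g).
    by rewrite -mcoeff_neq0 -E mcoeffUg mcoeff_neq0.
  case/msuppM_le => k1 [k2 []]; rewrite msuppU1 in_fset1 => /eqP-> _.
  by move/(congr1 (fun k : {cmonom nat} => k i)); rewrite !cmM bi; lia.
exists (\sum_(m <- msupp f) << f@_m *g divcm m a >>).
rewrite {1}[f]monalgE mulr_sumr !big_seq; apply: eq_bigr => m mf.
rewrite [RHS]malgM_def fgmulUU (mul1r f@_m).
suff <- : m = (a * divcm m a)%M by [].
by apply/eqP/cmP => i; rewrite cmM divcmE subnKC ?le.
Qed.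

Definition cmpow (i r : nat) : {cmonom nat} := iter r (mmul U_(i)%M) 1%M.

Lemma cmpowE i r j : cmpow i r j = ((i == j) * r)%N.
Proof.
elim: r => [|r IH]; first by rewrite cm1 muln0.
by rewrite /cmpow /= cmM cmU -/(cmpow i r) IH mulnS.
Qed.

Lemma pvarX i r : pvar K i ^+ r = << cmpow i r >>.
Proof.
elim: r => [|r IH]; first by rewrite expr0 /cmpow /= mpolyC1E.
rewrite [LHS]exprS IH; exact: malgUM.
Qed.

Lemma pvar_neq0 i : pvar K i != 0.
Proof. by rewrite monalgU_eq0 oner_eq0. Qed.

Lemma pvar_coprime i j r s f g : i != j ->
  pvar K j ^+ s * f = pvar K i ^+ r * g -> exists h, f = pvar K i ^+ r * h.
Proof.
move=> ij; apply: (monomial_divides (pvarX i r) (pvarX j s)) => k.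
rewrite !cmpowE; case: eqP => [<-|_]; last by left.
by right; rewrite eq_sym (negPf ij).
Qed.

End MonomialDivision.

(** * The grading modulo d and the product *)

Section Components.
Variables (K : fieldType) (n : nat) (B : free_lie_basis K n) (d : nat).
Local Notation P := (free_poisson B).
Implicit Types (f g h : P) (m : {cmonom nat}).

Definition mon m : P := << m >>.

Lemma fp_mdegM m1 m2 : fp_mdeg B (m1 * m2)%M = (fp_mdeg B m1 + fp_mdeg B m2)%N.
Proof. exact: cmweightM. Qed.

Lemma fp_mdeg1 : fp_mdeg B 1%M = 0%N.
Proof. exact: cmweight1. Qed.

Lemma fp_mdegU k : fp_mdeg B U_(k)%M = fl_deg B k.
Proof. exact: cmweightU. Qed.

Lemma componentP i f :
  reflect {in msupp f, forall m, fp_mdeg B m = i %[mod d]}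
    (f \in fp_component d i).
Proof. by apply: (iffP allP) => h m /h /eqP. Qed.

Lemma component0 i : (0 : P) \in fp_component d i.
Proof. by apply/componentP => m; rewrite msupp0. Qed.

Lemma component_lin i c f g : f \in fp_component d i ->
  g \in fp_component d i -> c *: f + g \in fp_component d i.
Proof.
move=> /componentP hf /componentP hg; apply/componentP => m.
move=> /(fsubsetP (msuppD_le _ _)); rewrite in_fsetU => /orP[|/hg //].
by move=> /(fsubsetP (msuppZ_le _ _)) /hf.
Qed.

Lemma componentM i j f g : f \in fp_component d i ->
  g \in fp_component d j -> f * g \in fp_component d (i + j).
Proof.
move=> /componentP hf /componentP hg; apply/componentP => m.
case/msuppM_le=> m1 [m2 [/hf h1 /hg h2 ->]].
by rewrite fp_mdegM -modnDm h1 h2 modnDm.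
Qed.

Lemma component_mon m : mon m \in fp_component d (fp_mdeg B m).
Proof. by apply/componentP => m'; rewrite msuppU1 in_fset1 => /eqP->. Qed.

Lemma component_mod i j f : i = j %[mod d] -> f \in fp_component d i ->
  f \in fp_component d j.
Proof. by move=> ij /componentP hf; apply/componentP => m /hf ->. Qed.

(** Multiplication by a monomial translates the support without cancellation, so degrees can be
    subtracted. *)
Lemma component_div i m f : mon m * f \in fp_component d (fp_mdeg B m + i) ->
  f \in fp_component d i.
Proof.
move=> /componentP h; apply/componentP => m' m'f; have := h (m * m')%M.
rewrite -mcoeff_neq0 mcoeffUg mcoeff_neq0 fp_mdegM => /(_ m'f) /eqP.
by rewrite eqn_modDl => /eqP.
Qed.

Lemma component_mon_ind i (Q : P -> Prop) : Q 0 ->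
  (forall c f g, Q f -> Q g -> Q (c *: f + g)) ->
  (forall m, fp_mdeg B m = i %[mod d] -> Q (mon m)) ->
  {in fp_component d i, forall f, Q f}.
Proof.
move=> Q0 Qlin Qm f /componentP hf; rewrite [f]malg_sumZ big_seq.
elim/big_rec: _ => [//|m g /hf/Qm Qmm Qg]; exact: Qlin.
Qed.

Lemma veronese1 : (1 : P) \in veronese d.
Proof.
have := component_mon 1%M; rewrite fp_mdeg1.
by rewrite /mon mpolyC1E.
Qed.

Lemma veroneseM : {in veronese d &, forall f g : P, f * g \in veronese d}.
Proof. by move=> f g hf hg; apply: (componentM hf hg). Qed.

Lemma componentX i f k : f \in fp_component d i ->
  f ^+ k \in fp_component d (k * i).
Proof.
move=> hf; elim: k => [|k IH]; first exact: veronese1.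
by rewrite exprS mulSn componentM.
Qed.

Lemma component_nat c : (c%:R : P) \in veronese d.
Proof.
elim: c => [|c IH]; first exact: component0.
rewrite -[c.+1]addn1 natrD -[c%:R](scale1r).
exact: (component_lin 1 IH veronese1).
Qed.

Lemma componentZ i c f : f \in fp_component d i -> c *: f \in fp_component d i.
Proof.
by move=> hf; have := component_lin c hf (component0 i); rewrite addr0.
Qed.

Lemma componentB i f g : f \in fp_component d i -> g \in fp_component d i ->
  f - g \in fp_component d i.
Proof.
by move=> hf hg; have := component_lin (-1) hg hf; rewrite scaleN1r addrC.
Qed.

End Components.

(** * Lifting a derivation of P_0 to P *)

Section VeroneseLift.
Variables (K : fieldType) (n : nat) (B : free_lie_basis K n) (d : nat).
Local Notation P := (free_poisson B).
Implicit Types (f g h : P) (m : {cmonom nat}).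
Hypothesis K0 : [pchar K] =i pred0.
Hypothesis d0 : (0 < d)%N.

Lemma poisson_domain f g : f * g = 0 -> (f == 0) || (g == 0).
Proof. exact: malg_domain. Qed.

Lemma mon1 : mon B 1%M = 1.
Proof. exact: mpolyC1E. Qed.

Lemma monM m1 m2 : mon B (m1 * m2)%M = mon B m1 * mon B m2.
Proof. exact/esym/malgUM. Qed.

Lemma mon_neq0 m : mon B m != 0.
Proof. by rewrite /mon monalgU_eq0 oner_eq0. Qed.

(* Any r with r + deg m = 0 mod d would do; this one is additive in m.        *)
Definition codeg m : nat := (d.-1 * fp_mdeg B m)%N.

Lemma codegM m1 m2 : codeg (m1 * m2)%M = (codeg m1 + codeg m2)%N.
Proof. by rewrite /codeg fp_mdegM mulnDr. Qed.

Lemma veronese_codeg (y : P) m : y \in fp_component d 1 ->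
  y ^+ codeg m * mon B m \in veronese d.
Proof.
move=> hy; have := componentM (componentX (codeg m) hy) (component_mon B d m).
apply: component_mod; rewrite muln1 /codeg -[X in (_ + X)%N]mul1n -mulnDl addn1.
by rewrite prednK // modnMr mod0n.
Qed.

Lemma veronese_exp (y : P) : y \in fp_component d 1 -> y ^+ d \in veronese d.
Proof.
by move=> /(componentX d); apply: component_mod; rewrite muln1 modnn mod0n.
Qed.

Variable D0 : P -> P.
Hypothesis hD0 : derivation_on (veronese d) D0.

Let DS f : f \in veronese d -> D0 f \in veronese d.
Proof. case: hD0 => h _ _ _; exact: h. Qed.
Let DM : {in veronese d &, forall f g, D0 (f * g) = D0 f * g + f * D0 g}.
Proof. case: hD0 => _ _ h _; exact: h. Qed.

Variables k l : nat.
Hypothesis kl : k != l.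
Hypothesis dk : fl_deg B k = 1%N.
Hypothesis dl : fl_deg B l = 1%N.
Let y : P := pvar K k.
Let z : P := pvar K l.

Let pvar_comp i : fl_deg B i = 1%N -> (pvar K i : P) \in fp_component d 1.
Proof. by move=> h; have := component_mon B d U_(i)%M; rewrite fp_mdegU h. Qed.

Let hy : y \in fp_component d 1 := pvar_comp dk.
Let hz : z \in fp_component d 1 := pvar_comp dl.
Let y0 : y != 0 := pvar_neq0 K k.
Let z0 : z != 0 := pvar_neq0 K l.

Lemma loglift_exists m : exists h, loglift D0 d y (codeg m) (mon B m) h.
Proof.
have := @logder_cross K P poisson_domain (veronese d) D0 (veronese1 B d)
  (@veroneseM K n B d) DM d (codeg m) y z (mon B m) y0 z0 (mon_neq0 m)
  (veronese_exp hy) (veronese_exp hz)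
  (veronese_codeg m hy) (veronese_codeg m hz).
(* Coprimality of y and z makes the right-hand side of [loglift] equal to y^(codeg m + d) h; the
   factor d is then inverted. *)
case/(pvar_coprime kl) => h E; exists ((d%:R^-1 : K) *: h).
apply: etrans (esym E).
have dK : d%:R != 0 :> K by rewrite ((pcharf0P K).1 K0) -lt0n.
have aux (A : comAlgType K) (a b : A) : d%:R * a * ((d%:R^-1 : K) *: b) = a * b.
  rewrite -scalerAr -mulrA mulr_natl -scaler_nat scalerA.
  by rewrite mulVf // scale1r.
exact: aux.
Qed.

Lemma lift_var i : {h : P | loglift D0 d y (codeg U_(i)%M) (mon B U_(i)%M) h}.
Proof. exact/sig_eqW/loglift_exists. Qed.

(** Values are chosen at the variables only, so linearity and the product rule are automatic; the
    relation at other monomials follows in [lift_mon]. *)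
Definition veronese_lift : P -> P :=
  pderiv (fun i => sval (lift_var i)).
Local Notation D := veronese_lift.

Lemma lift_lin c f g : D (c *: f + g) = c *: D f + D g.
Proof. exact: pderiv_lin. Qed.

Lemma liftM f g : D (f * g) = D f * g + f * D g.
Proof. exact: pderivM. Qed.

Lemma lift0 : D 0 = 0.
Proof. exact: pderiv0. Qed.

Lemma lift1 : D 1 = 0.
Proof. exact: (@der1 K P predT D isT (fun f g _ _ => liftM f g)). Qed.

Lemma lift_mon m : loglift D0 d y (codeg m) (mon B m) (D (mon B m)).
Proof.
elim/cmonom_nat_ind: m => [|i m IH].
  rewrite /codeg fp_mdeg1 muln0 mon1 lift1.
  exact: (loglift1 (veronese1 B d) DM).
rewrite codegM monM liftM.
refine (logliftM DM (veronese_codeg _ hy) (veronese_codeg _ hy) _ IH).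
have -> : D (mon B U_(i)%M) = sval (lift_var i) by exact: pderiv_var.
exact: svalP.
Qed.

Lemma lift_veronese : {in veronese d, D =1 D0}.
Proof.
case: hD0 => _ lin0 _ _ f Sf.
(* Membership is carried through the induction because [D0] is linear on P_0 only. *)
suff: f \in veronese d /\ D f = D0 f by case.
move: f Sf; apply: component_mon_ind => [|c f g [Sf Ef] [Sg Eg]|m hm].
- split; first exact: component0.
  have := lin0 _ _ (component0 B d 0) (component0 B d 0) (-1).
  by rewrite lift0 !scaleN1r !addNr.
- split; first exact: component_lin.
  by rewrite lift_lin lin0 // Ef Eg.
have Sm : mon B m \in veronese d.
  exact: (component_mod hm (component_mon B d m)).
split=> //; have := lift_mon m.
have /dvdnP[s ->] : (d %| codeg m)%N.
  by rewrite /codeg dvdn_mull // /dvdn hm mod0n.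
rewrite mulnC.
exact: (loglift_subset K0 poisson_domain (veronese1 B d) (@veroneseM K n B d) DM
  d0 y0 (veronese_exp hy) Sm).
Qed.

(** For a monomial m the right-hand side of [loglift] lies in P_0. Dividing by y^(codeg m + d)
    leaves the class of -codeg m, which is that of deg m. *)
Lemma lift_component i f : f \in fp_component d i -> D f \in fp_component d i.
Proof.
move: f; apply: component_mon_ind => [|c f g hf hg|m hm].
- rewrite lift0; exact: component0.
- by rewrite lift_lin component_lin.
apply: (component_mod hm).
have d_inv : D (mon B m) = (d%:R^-1 : K) *: (d%:R * D (mon B m)).
  have dK : d%:R != 0 :> K by rewrite ((pcharf0P K).1 K0) -lt0n.
  by rewrite mulr_natl -scaler_nat scalerA mulVf // scale1r.
rewrite d_inv; apply: componentZ.
have yE : y ^+ (codeg m + d) = mon B (cmpow k (codeg m + d)) := pvarX K k _.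
have degy r : fp_mdeg B (cmpow k r) = r.
  elim: r => [|r IH]; first exact: fp_mdeg1.
  by rewrite /cmpow /= fp_mdegM IH fp_mdegU dk.
apply: (@component_div _ _ _ d _ (cmpow k (codeg m + d))).
rewrite degy -yE.
have L := lift_mon m; rewrite /loglift in L.
have aux (A : comAlgType K) (a b c : A) : b * (a * c) = a * b * c.
  by rewrite mulrA [b * a]mulrC.
rewrite aux L.
apply: (@component_mod _ _ _ _ 0).
  rewrite addnAC /codeg -[X in (_ + X + _)%N]mul1n -mulnDl addn1 prednK //.
  by rewrite -modnDm modnMr modnn mod0n.
have nm c f g : f \in veronese d -> g \in veronese d ->
    c%:R * f * g \in veronese d.
  by move=> Sf Sg; apply/veroneseM/Sg/veroneseM/Sf/component_nat.
apply: componentB; apply: nm.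
- exact: veronese_exp.
- exact/DS/veronese_codeg.
- exact: veronese_codeg.
exact/DS/veronese_exp.
Qed.

Lemma lift_nilpotent : locally_nilpotent_on (veronese d) D0 ->
  locally_nilpotent_on predT D.
Proof.
move=> nil0.
have DD : {morph D : a b / a + b}.
  by move=> a b; have := lift_lin 1 a b; rewrite !scale1r.
have iter_eq r f : f \in veronese d -> iter r D f = iter r D0 f.
  move=> Sf; suff [//] : iter r D f = iter r D0 f /\ iter r D f \in veronese d.
  elim: r => [|r [IH1 IH2]]; first by split.
  rewrite /= -IH1 (lift_veronese IH2); split; [reflexivity|exact: DS].
(* The power argument runs inside the component of m, which is stable under [D] and whose d-th
   powers lie in P_0. *)
have nilmon m : exists r, iter r D (mon B m) = 0.
  apply: (nilpotent_of_power K0 poisson_domain DD liftM d0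
            (T := fp_component d (fp_mdeg B m))).
  - exact: lift_component.
  - move=> f Sf; have Sd : f ^+ d \in veronese d.
      by apply: component_mod (componentX d Sf); rewrite modnMr mod0n.
    by have [r _ h] := nil0 _ Sd; exists r; rewrite iter_eq.
  exact: component_mon.
suff nil f : exists r, iter r D f = 0.
  move=> f _; have [r h] := nil f; exists r.+1 => //=.
  rewrite h; exact: lift0.
elim/(@malg_linear_ind K): f => [c f g [r fr] [s gs]|m]; last exact: nilmon.
have iter0 t : iter t D 0 = 0 by elim: t => //= t ->; exact: lift0.
have iter_lin t : iter t D (c *: f + g) = c *: iter t D f + iter t D g.
  by elim: t => //= t ->; exact: lift_lin.
exists (r + s)%N; have iter_gt t u a : iter u D a = 0 -> iter (t + u) D a = 0.
  by rewrite iterD => ->.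
rewrite iter_lin (iter_gt r s g gs) addnC (iter_gt s r f fr) scaler0.
exact: addr0.
Qed.

Hypothesis veronese_lie :
  {in veronese d &, forall f g : P, lie f g \in veronese d}.

Lemma derivation_eq0 (E : P -> P) :
  (forall c f g, E (c *: f + g) = c *: E f + E g) ->
  (forall f g, E (f * g) = E f * g + f * E g) ->
  {in veronese d, forall f, E f = 0} -> forall f, E f = 0.
Proof.
move=> Elin EM E0; have ED : {morph E : a b / a + b}.
  by move=> a b; have := Elin 1 a b; rewrite !scale1r.
elim/(@malg_linear_ind K) => [c f g hf hg|m].
  by rewrite Elin hf hg scaler0 addr0.
apply: (der_exp_eq0 K0 poisson_domain ED EM d0); apply: E0.
have := componentX d (component_mon B d m); apply: component_mod.
by rewrite modnMr mod0n.
Qed.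

(** The defect vanishes on P_0 x P_0; [derivation_eq0] frees the second argument, and antisymmetry
    then frees the first. *)
Lemma lift_lie f g : D (lie f g) = lie (D f) g + lie f (D g).
Proof.
have defect0 u : (forall v, v \in veronese d -> lie_defect D u v = 0) ->
    forall v, lie_defect D u v = 0.
  move=> Eu; apply: derivation_eq0 => [c a b|a b|v Sv].
  - exact: (lie_defect_linr lift_lin).
  - exact: (lie_defectMr lift_lin liftM).
  - exact: Eu.
have E0 u : u \in veronese d -> forall v, lie_defect D u v = 0.
  move=> Su; apply: defect0 => v Sv; apply/eqP; rewrite subr_eq0; apply/eqP.
  rewrite (lift_veronese (veronese_lie Su Sv)) (lift_veronese Su).
  rewrite (lift_veronese Sv); case: hD0 => _ _ _ h; exact: h.
have : lie_defect D f g = 0.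
  apply: defect0 => v Sv; rewrite (lie_defectC lift_lin) (E0 v Sv).
  exact: oppr0.
by move/eqP; rewrite subr_eq0 => /eqP.
Qed.

End VeroneseLift.

(** * Homogeneous elements of the free Lie algebra *)

Section FreeLieGrading.
Variables (K : fieldType) (n : nat) (B : free_lie_basis K n).
Hypothesis K0 : [pchar K] =i pred0.
Local Notation e := (fl_basis B).

Lemma natf_inj a b : a%:R = b%:R :> K -> a = b.
Proof.
wlog le : a b / (a <= b)%N.
  by move=> W E; case/orP: (leq_total a b) => /W -> //.
move/esym/eqP; rewrite -subr_eq0 -natrB // ((pcharf0P K).1 K0) subn_eq0 => ge.
by apply/eqP; rewrite eqn_leq le.
Qed.

Lemma lie0l (u : fl_lie B) : lie 0 u = 0.
Proof. by apply: (addrI (lie 0 u)); rewrite -lieDl !addr0. Qed.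

Lemma lie0r (u : fl_lie B) : lie u 0 = 0.
Proof. by apply: (addrI (lie u 0)); rewrite -lieDr !addr0. Qed.

Lemma fl_basis_neq0 k : e k != 0.
Proof.
apply/eqP => e0; have := (fl_basisP B).1 (rcons (nseq k 0) 1).
rewrite /lincomb size_rcons size_nseq big_ord_recr /= e0 scaler0 addr0.
rewrite big1 => [|i _]; last first.
  by rewrite nth_rcons size_nseq ltn_ord nth_nseq ltn_ord scale0r.
move=> /(_ erefl k); rewrite nth_rcons size_nseq ltnn eqxx => /eqP.
by rewrite oner_eq0.
Qed.

(** By freeness some morphism sends every generator to the nonzero vector [e 0]. *)
Lemma fl_gen_neq0 i : fl_gen B i != 0.
Proof.
have [f [[flin _] fx] _] := fl_free B (fun _ => e 0%N).
apply/eqP => x0; have /eqP[] := fl_basis_neq0 0%N.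
by rewrite -(fx i) x0; have := flin (-1) 0 0; rewrite !scaleN1r !addNr.
Qed.

Variables (w : 'I_n -> nat) (W : {cmonom 'I_n} -> nat).
Hypothesis WM : forall a b, W (a * b)%M = (W a + W b)%N.
Hypothesis WU : forall i, W U_(i)%M = w i.

(* The Lie endomorphism x_i |-> 2^(w i) x_i acts on the multidegree a as the  *)
(* scalar 2^(W a), so it separates the W-homogeneous components.              *)
Lemma homogeneous_support a (u : fl_lie B) s k :
  multihomogeneous (fl_gen B) a u -> u = lincomb e s -> s`_k != 0 ->
  W (fl_mdeg B k) = W a.
Proof.
move=> ha us sk.
have [f [[flin fM] fx] _] := fl_free B (fun i => (2 ^ w i)%:R *: fl_gen B i).
have f0 : f 0 = 0 by have := flin (-1) 0 0; rewrite !scaleN1r !addNr.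
have fh b v : multihomogeneous (fl_gen B) b v -> f v = (2 ^ W b)%:R *: v.
  elim=> {b v} [i|b c v z _ IHv _ IHz|b|b c v z _ IHv _ IHz].
  - by rewrite fx WU.
  - rewrite fM IHv IHz WM expnD natrM.
    have lieZZ (p q : K) : lie (p *: v) (q *: z) = (p * q) *: lie v z.
      have := lie_linearl p v 0 (q *: z); rewrite lie0l !addr0 => ->.
      have := lie_linearr q z 0 v; rewrite lie0r !addr0 => ->.
      by rewrite scalerA.
    exact: lieZZ.
  - by rewrite f0 scaler0.
  by rewrite flin IHv IHz scalerDr !scalerA mulrC.
have flc t : f (lincomb e t) = \sum_(i < size t) t`_i *: f (e i).
  rewrite /lincomb; elim/big_rec2: _ => // i p q _ <-; exact: flin.
(* Coordinates of f(u) - 2^(W a) u, which is zero because u is an eigenvector of f. *)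
pose t := mkseq
  (fun i => s`_i * ((2 ^ W (fl_mdeg B i))%:R - (2 ^ W a)%:R)) (size s).
have t0 : lincomb e t = 0.
  have := fh _ _ ha; rewrite us flc => h.
  rewrite /lincomb size_mkseq.
  transitivity (\sum_(i < size s) s`_i *: f (e i)
                - (2 ^ W a)%:R *: lincomb e s).
    rewrite /lincomb scaler_sumr -sumrB; apply: eq_bigr => i _.
    rewrite nth_mkseq // (fh _ _ (fl_homog B i)) mulrBr scalerBl !scalerA.
    by rewrite [s`_i * (2 ^ W a)%:R]mulrC.
  by rewrite h subrr.
have ks : (k < size s)%N.
  by rewrite ltnNge; apply: contra sk => ?; rewrite nth_default.
have := (fl_basisP B).1 t t0 k; rewrite nth_mkseq // => /eqP.
rewrite mulf_eq0 (negPf sk) /= subr_eq0 => /eqP E.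
by have /eqP := natf_inj E; rewrite eqn_exp2l // => /eqP.
Qed.

End FreeLieGrading.

(** * The bracket and the grading; variables of degree 1 *)

Section PoissonGrading.
Variables (K : fieldType) (n : nat) (B : free_lie_basis K n) (d : nat).
Hypothesis K0 : [pchar K] =i pred0.
Local Notation P := (free_poisson B).
Implicit Types (f g h : P) (m : {cmonom nat}).

Lemma of_lie_component a (u : fl_lie B) : multihomogeneous (fl_gen B) a u ->
  of_lie u \in fp_component d (mdeg a).
Proof.
move=> ha; have [s /eqP us] := (fl_basisP B).2 u.
rewrite us of_lieE /lincomb.
apply: (big_ind (fun f : P => f \in fp_component d (mdeg a)))
  => [|f g hf hg|i _].
- exact: component0.
- rewrite -[f]scale1r; exact: component_lin.
have [->|si] := eqVneq s`_i 0; first by rewrite scale0r component0.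
apply: componentZ.
have <- : fl_deg B i = mdeg a.
  by apply: (homogeneous_support K0 (@mdegM _) (@mdegU _) ha us si).
have := component_mon B d U_(i : nat)%M; rewrite fp_mdegU; exact.
Qed.

Lemma fp_gen_component i : fp_gen B i \in fp_component d 1.
Proof.
have := of_lie_component (Multihomog_gen (fl_gen B) i); rewrite mdegU; exact.
Qed.

(** The Leibniz rule in both arguments reduces to two variables, where the bracket is that of two
    homogeneous basis elements of the Lie algebra. *)
Lemma component_lie_mon m1 m2 :
  lie (mon B m1) (mon B m2) \in fp_component d (fp_mdeg B m1 + fp_mdeg B m2).
Proof.
have lie1l g : lie (1 : P) g = 0.
  exact: (@der1 K P predT (fun f => lie f g) isT (fun f h _ _ => brMl f h g)).
have lie1r g : lie g (1 : P) = 0.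
  rewrite lieC lie1l; exact: oppr0.
elim/cmonom_nat_ind: m1 m2 => [|i m1 IH1] m2.
  rewrite mon1 lie1l; exact: component0.
have lieMl f g h : lie (f * g) h = lie f h * g + f * lie g h by exact: brMl.
rewrite monM lieMl fp_mdegM -[X in X + _]scale1r; apply: component_lin.
  rewrite addnAC; apply: componentM; last exact: component_mon.
  elim/cmonom_nat_ind: m2 => [|j m2 IH2].
    rewrite mon1 lie1r; exact: component0.
  rewrite monM lie_leibniz fp_mdegM -[X in X + _]scale1r; apply: component_lin.
    rewrite addnCA; apply: componentM; [exact: component_mon|exact: IH2].
  rewrite addnA; apply: componentM; last exact: component_mon.
  rewrite !fp_mdegU (br_var B i j : lie (mon B U_(i)%M) (mon B U_(j)%M) = _).
  have := of_lie_component (Multihomog_lie (fl_homog B i) (fl_homog B j)).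
  rewrite mdegM; exact.
rewrite -addnA; apply: componentM; [exact: component_mon|exact: IH1].
Qed.

Lemma component_lie i j f g : f \in fp_component d i ->
  g \in fp_component d j -> lie f g \in fp_component d (i + j).
Proof.
move=> hf hg; move: f hf; apply: component_mon_ind => [|c f h hf hh|m1 h1].
- rewrite (_ : lie 0 g = 0); first exact: component0.
  by have := brDl (-1) 0 0 g; rewrite !scaleN1r !addNr.
- have -> : lie (c *: f + h) g = c *: lie f g + lie h g by exact: brDl.
  exact: (component_lin c hf hh).
move: g hg; apply: component_mon_ind => [|c f h hf hh|m2 h2].
- rewrite (_ : lie (mon B m1) 0 = 0); first exact: component0.
  exact: br0r.
- have -> : lie (mon B m1) (c *: f + h)
            = c *: lie (mon B m1) f + lie (mon B m1) h.
    exact: brDr.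
  exact: (component_lin c hf hh).
apply: component_mod (component_lie_mon m1 m2).
by rewrite -modnDm h1 h2 modnDm.
Qed.

(** Any basis element occurring in x_i will do: [homogeneous_support] is used with the total degree
    and with each single exponent as weight. *)
Lemma degree1_basis i : exists2 k, fl_deg B k = 1%N &
  forall j, fl_mdeg B k j = (i == j) :> nat.
Proof.
have [s /eqP us] := (fl_basisP B).2 (fl_gen B i).
have [k sk] : exists k, s`_k != 0.
  have [/hasP[c cs c0]|/hasPn z] := boolP (has (fun c => c != 0) s).
    by exists (index c s); rewrite nth_index.
  case/eqP: (fl_gen_neq0 B i); rewrite us /lincomb big1 // => k _.
  have /z := mem_nth 0 (ltn_ord k); rewrite negbK => /eqP ->; exact: scale0r.
exists k.
  apply: etrans (mdegU i).
  exact: (homogeneous_support K0 (@mdegM _) (@mdegU _)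
            (Multihomog_gen _ i) us sk).
move=> j; apply: etrans (cmU i j).
exact: (homogeneous_support K0 (W := fun a => a j) (cmM j)
  (fun i' => cmU i' j) (Multihomog_gen _ i) us sk).
Qed.

End PoissonGrading.

Theorem lemma3 (K : fieldType) (hK : [pchar K] =i pred0)
    (n d : nat) (hn : (2 <= n)%N) (hd : (2 <= d)%N)
    (B : free_lie_basis K n)
    (D0 : free_poisson B -> free_poisson B)
    (hD0 : derivation_on (veronese d) D0)
    (hnil : locally_nilpotent_on (veronese d) D0) :
  exists D : free_poisson B -> free_poisson B,
    [/\ derivation_on predT D,
        locally_nilpotent_on predT D,
        d_graded d D
      & {in veronese d, D =1 D0}].
Proof.
have d0 : (0 < d)%N := ltnW hd.
pose i0 : 'I_n := Ordinal (ltnW hn); pose i1 : 'I_n := Ordinal hn.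
have [k dk hk] := degree1_basis B hK i0.
have [l dl hl] := degree1_basis B hK i1.
(* The multidegrees of the two basis elements differ at [i0]. *)
have kl : k != l.
  by apply/eqP => E; have := hk i0; rewrite E hl eqxx.
exists (veronese_lift hK d0 hD0 kl dk dl); split.
- split=> [//|f g _ _ c|f g _ _|f g _ _].
  + exact: lift_lin.
  + exact: liftM.
  + apply: lift_lie => u v hu hv; exact: (component_lie hK hu hv).
- exact: lift_nilpotent.
- move=> i; exact/lift_component/fp_gen_component.
- exact: lift_veronese.
Qed.
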